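(* Let $\rho_0$ be a reference probability density on $\mathbb{R}^d$, let $\hat{\mathbf{x}}^{(1)},\dots,\hat{\mathbf{x}}^{(N)}\in\mathbb{R}^d$ be samples from a predictive distribution $\rho_1$, let $\mathbf{z}_0^{(n)}\sim\rho_0$ and set $\mathbf{z}_1^{(n)}=\hat{\mathbf{x}}^{(n)}$, $n\in[N]$. Let $\mathbf{y}$ be an observation and $p(\mathbf{y}\mid\mathbf{x})>0$ a likelihood, and define the likelihood weights $w_n(\mathbf{y})=p(\mathbf{y}\mid\hat{\mathbf{x}}^{(n)})/\sum_{m=1}^N p(\mathbf{y}\mid\hat{\mathbf{x}}^{(m)})$. Let $\sigma_{\min}>0$ and suppose the conditional paths satisfy $p_1(\mathbf{z}\mid\mathbf{z}_0,\mathbf{z}_1)=\mathcal{N}(\mathbf{z}\mid\mathbf{z}_1,\sigma_{\min}^2 I)$ and $p_t(\mathbf{z}\mid\mathbf{z}_0^{(n)},\mathbf{z}_1^{(n)})>0$ for all $t,\mathbf{z},n$. Define the Monte-Carlo-guided vector field $$\mathbf{u}^{\mathrm{MCG}}_t(\mathbf{z};\mathbf{y})=\sum_{n=1}^N w_n'(\mathbf{z};\mathbf{y})\,\mathbf{u}_t(\mathbf{z}\mid\mathbf{z}_0^{(n)},\mathbf{z}_1^{(n)}),\qquad w_n'(\mathbf{z};\mathbf{y})=\frac{p(\mathbf{y}\mid\hat{\mathbf{x}}^{(n)})\,p_t(\mathbf{z}\mid\mathbf{z}_0^{(n)},\mathbf{z}_1^{(n)})}{\sum_{m=1}^N p(\mathbf{y}\mid\hat{\mathbf{x}}^{(m)})\,p_t(\mathbf{z}\mid\mathbf{z}_0^{(m)},\mathbf{z}_1^{(m)})}.$$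 Assume the flow $\boldsymbol\phi^{\mathbf{y}}_t(\cdot;\sigma_{\min})$ of $\mathbf{u}^{\mathrm{MCG}}_t(\cdot;\mathbf{y})$ exists on $[0,1]$ and that $(\boldsymbol\phi^{\mathbf{y}}_t)_\#\rho_0$ is the unique solution, among paths of probability densities, of $\partial_t q_t+\nabla\cdot(q_t\mathbf{u}^{\mathrm{MCG}}_t)=0$, $q_0=\rho_0$. Then $(\boldsymbol\phi^{\mathbf{y}}_t)_\#\rho_0=\sum_{n=1}^N w_n(\mathbf{y})p_t(\cdot\mid\mathbf{z}_0^{(n)},\mathbf{z}_1^{(n)})$, so that $$(\boldsymbol\phi^{\mathbf{y}}_1)_\#\rho_0=\sum_{n=1}^N w_n(\mathbf{y})\,\mathcal{N}(\cdot\mid\hat{\mathbf{x}}^{(n)},\sigma_{\min}^2 I),$$ and as $\sigma_{\min}\to0$ this measure converges weakly to the bootstrap-particle-filter resampling measure $\rho^N_{\mathrm{BPF}}(d\mathbf{z};\mathbf{y})=\sum_{n=1}^N w_n(\mathbf{y})\delta_{\hat{\mathbf{x}}^{(n)}}(d\mathbf{z})$. Equivalently, if $\mathbf{x}_0\sim\rho_0$, then $\boldsymbol\phi^{\mathbf{y}}_1(\mathbf{x}_0;\sigma_{\min})$ converges in distribution, as $\sigma_{\min}\to0$, to a random variable with law $\rho^N_{\mathrm{BPF}}(\cdot;\mathbf{y})$.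
   Context: For each pair $(\mathbf{z}_0,\mathbf{z}_1)$, $\{p_t(\cdot\mid\mathbf{z}_0,\mathbf{z}_1)\}_{t\in[0,1]}$ is a path of probability densities on $\mathbb{R}^d$ and $\mathbf{u}_t(\cdot\mid\mathbf{z}_0,\mathbf{z}_1)$ a time-dependent vector field generating it, i.e. $\partial_t p_t(\mathbf{z}\mid\mathbf{z}_0,\mathbf{z}_1)+\nabla_{\mathbf{z}}\cdot[p_t(\mathbf{z}\mid\mathbf{z}_0,\mathbf{z}_1)\mathbf{u}_t(\mathbf{z}\mid\mathbf{z}_0,\mathbf{z}_1)]=0$ with $p_0(\cdot\mid\mathbf{z}_0,\mathbf{z}_1)=\rho_0$. For a measurable map $T$ and measure $\mu$, $T_\#\mu(B)=\mu(T^{-1}(B))$. Weak convergence means convergence of integrals of all bounded continuous functions. The bootstrap particle filter's analysis step resamples the particles $\hat{\mathbf{x}}^{(n)}$ with probabilities proportional to $p(\mathbf{y}\mid\hat{\mathbf{x}}^{(n)})$, i.e. draws from $\rho^N_{\mathrm{BPF}}$. *)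

(* Defs.v *)
From HB Require Import structures.
From mathcomp Require Import all_boot all_order all_algebra.
From mathcomp Require Import all_classical all_reals all_analysis.
Set Implicit Arguments. Unset Strict Implicit. Unset Printing Implicit Defensive.
Import Order.TTheory GRing.Theory Num.Theory.
Import numFieldNormedType.Exports.
Local Open Scope classical_set_scope.
Local Open Scope ring_scope.

Section FlowMatching.
Variable R : realType.

Definition rowcons (d : nat) (x : R) (v : 'rV[R]_d) : 'rV[R]_d.+1 :=
  \row_(i < d.+1) (if unlift ord0 i is Some j then v ord0 j else x).

(* Lebesgue integral on R^d, as the iterated Lebesgue integral over the
   coordinates (equal to the integral w.r.t. d-dimensional Lebesgue measure
   for Borel functions that are nonnegative or integrable, by Fubini-Tonelli). *)
Fixpoint lebint (d : nat) : ('rV[R]_d -> \bar R) -> \bar R :=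
  match d return ('rV[R]_d -> \bar R) -> \bar R with
  | 0 => fun f => f 0
  | d'.+1 => fun f =>
      (\int[@lebesgue_measure R]_x lebint (fun v => f (rowcons x v)))%E
  end.

Definition borelRd (d : nat) (B : set 'rV[R]_d) : Prop := <<s (@open 'rV[R]_d) >> B.

Definition borel_fun (d : nat) (f : 'rV[R]_d -> R) : Prop :=
  forall B : set R, measurable B -> borelRd (f @^-1` B).

Definition prob_density (d : nat) (f : 'rV[R]_d -> R) : Prop :=
  [/\ borel_fun f, (forall z, 0 <= f z) & lebint (fun z => (f z)%:E) = 1%E].

Definition density_path (d : nat) (q : R -> 'rV[R]_d -> R) : Prop :=
  forall t, t \in `[0, 1] -> prob_density (q t).

Definition basis_vec (d : nat) (i : 'I_d) : 'rV[R]_d := delta_mx 0 i.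

Definition div_derivable (d : nat) (F : 'rV[R]_d -> 'rV[R]_d) (z : 'rV[R]_d) :=
  forall i : 'I_d, derivable F z (basis_vec i).
Definition divergence (d : nat) (F : 'rV[R]_d -> 'rV[R]_d) (z : 'rV[R]_d) : R :=
  \sum_(i < d) ('D_(basis_vec i) F z) ord0 i.

Definition solves_CE (d : nat) (q : R -> 'rV[R]_d -> R)
    (v : R -> 'rV[R]_d -> 'rV[R]_d) (q0 : 'rV[R]_d -> R) : Prop :=
  [/\ (forall z, q 0 z = q0 z),
      (forall z, {within `[0, 1], continuous (fun s => q s z)}) &
      (forall t, t \in `]0, 1[ -> forall z,
          [/\ derivable (fun s => q s z) t 1,
              div_derivable (fun z' => q t z' *: v t z') z &
              'D_1 (fun s => q s z) t = - divergence (fun z' => q t z' *: v t z') z])].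

Definition is_flow (d : nat) (v : R -> 'rV[R]_d -> 'rV[R]_d)
    (phi : R -> 'rV[R]_d -> 'rV[R]_d) : Prop :=
  forall x, [/\ phi 0 x = x,
     {within `[0, 1], continuous (fun s => phi s x)} &
     forall t, t \in `]0, 1[ ->
        derivable (fun s => phi s x) t 1 /\
        'D_1 (fun s => phi s x) t = v t (phi t x)].

Definition pushforward_has_density (d : nat) (phi : 'rV[R]_d -> 'rV[R]_d)
    (rho0 q : 'rV[R]_d -> R) : Prop :=
  forall B : set 'rV[R]_d, borelRd B ->
    lebint (fun x => (\1_(phi @^-1` B) x * rho0 x)%:E) =
    lebint (fun z => (\1_B z * q z)%:E).

Definition sqnorm (d : nat) (v : 'rV[R]_d) : R := \sum_(i < d) (v ord0 i) ^+ 2.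
Definition gauss (d : nat) (m : 'rV[R]_d) (s : R) (z : 'rV[R]_d) : R :=
  (Num.sqrt (2 * pi * s ^+ 2)) ^- d * expR (- sqnorm (z - m) / (2 * s ^+ 2)).

Definition lik_weight (N d : nat) (L : 'rV[R]_d -> R) (xhat : 'I_N -> 'rV[R]_d)
    (n : 'I_N) : R :=
  L (xhat n) / \sum_(m < N) L (xhat m).

Definition u_MCG (N d : nat) (L : 'rV[R]_d -> R)
    (p : R -> 'rV[R]_d -> 'rV[R]_d -> 'rV[R]_d -> R)
    (u : R -> 'rV[R]_d -> 'rV[R]_d -> 'rV[R]_d -> 'rV[R]_d)
    (z0 xhat : 'I_N -> 'rV[R]_d) (t : R) (z : 'rV[R]_d) : 'rV[R]_d :=
  \sum_(n < N)
    ((L (xhat n) * p t z (z0 n) (xhat n)) /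
       (\sum_(m < N) L (xhat m) * p t z (z0 m) (xhat m))) *: u t z (z0 n) (xhat n).

End FlowMatching.

(* Main.v *)
Require Import Defs.
From HB Require Import structures.
From mathcomp Require Import all_boot all_order all_algebra.
From mathcomp Require Import all_classical all_reals all_analysis.
From mathcomp Require Import finmap measurable_realfun ring lra.
Import Order.TTheory GRing.Theory Num.Theory.
Import numFieldNormedType.Exports.
Local Open Scope classical_set_scope.
Local Open Scope ring_scope.

Set Implicit Arguments. Unset Strict Implicit. Unset Printing Implicit Defensive.

(* The continuity equation is linear in the flux [q *: v], and the weights of
   [u_MCG] are chosen so that the flux of the mixture [\sum_n w_n p_t] is the
   mixture of the conditional fluxes; hence the mixture solves the continuity
   equation of [u_MCG] and uniqueness identifies it with the pushforward. At
   time 1 it is a Gaussian mixture, whose components concentrate at the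
   particles as [s -> 0].

   The flow is not assumed measurable, so the integral of [f (phi s 1 x) * rho0 x]
   is only an iterated lower integral. On nonnegative functions this functional
   is still monotone and superadditive, which together with the knowledge of
   the mass of every preimage of a Borel set determines its value. *)

(** * Lower integrals *)

Section lower_integral.
Context d (T : measurableType d) (R : realType).
Variable mu : {measure set T -> \bar R}.
Local Open Scope ereal_scope.
Implicit Types f g u w C : T -> \bar R.

Import HBNNSimple.

(** The integral of a nonnegative function, measurable or not, is a supremum over its simple
    minorants. Testing against these is how lower integrals are bounded from above in this
    section. *)
Lemma ge0_integral_leP f M : (forall x, 0 <= f x) ->
  (forall h : {nnsfun T >-> R}, (forall x, (h x)%:E <= f x) ->
    \int[mu]_x (h x)%:E <= M) ->
  \int[mu]_x f x <= M.
Proof.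
move=> f0 H; rewrite ge0_integralTE//.
apply: ge_ereal_sup => _ /= [h hf <-].
by rewrite -integralT_nnsfun; exact: H.
Qed.

Lemma nnsfun_integral_le f (h : {nnsfun T >-> R}) :
  (forall x, (h x)%:E <= f x) -> \int[mu]_x (h x)%:E <= \int[mu]_x f x.
Proof.
move=> hf; rewrite [leRHS]ge0_integralTE; last first.
  by move=> x; apply: le_trans (hf x); rewrite lee_fin.
by apply: ereal_sup_ubound; exists h => //; rewrite -integralT_nnsfun.
Qed.

(** Positive parts grow with the function and negative parts shrink, which reduces the signed case
    to the nonnegative one. *)
Lemma le_integral_lower f g :
  (forall x, f x <= g x) -> \int[mu]_x f x <= \int[mu]_x g x.
Proof.
have ge0 a b : (forall x, 0 <= a x) -> (forall x, a x <= b x) ->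
    \int[mu]_x a x <= \int[mu]_x b x.
  move=> a0 ab; apply: ge0_integral_leP => // h ha.
  by apply: nnsfun_integral_le => x; exact: le_trans (ha x) (ab x).
move=> fg; rewrite (integralE _ _ f) (integralE _ _ g); apply: leeB.
- apply: ge0 => x; first exact: funepos_ge0.
  by rewrite !funeposE ge_max !le_max fg lexx orbT.
- apply: ge0 => x; first exact: funeneg_ge0.
  by rewrite !funenegE ge_max !le_max leeN2 fg lexx orbT.
Qed.

Lemma lower_integralZl_ge (r : R) f : (0 <= r)%R -> (forall x, 0 <= f x) ->
  r%:E * \int[mu]_x f x <= \int[mu]_x (r%:E * f x).
Proof.
rewrite le_eqVlt => /predU1P[<- f0|r0 f0].
  by rewrite mul0e; apply: integral_ge0 => x _; rewrite mul0e.
rewrite -lee_pdivlMl//; apply: ge0_integral_leP => // h hf.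
rewrite lee_pdivlMl// -ge0_integralZl_EFin//; last 3 first.
- by move=> x _; rewrite lee_fin.
- exact/measurable_EFinP.
- exact: ltW.
by apply: le_integral_lower => x; rewrite lee_pmul2l.
Qed.

(** If [h] and [k] are simple minorants of [f] and [g], then [h + k] lies below [f + g]. Equality
    can fail for non-measurable functions. *)
Lemma integral_superadd f g : (forall x, 0 <= f x) -> (forall x, 0 <= g x) ->
  \int[mu]_x f x + \int[mu]_x g x <= \int[mu]_x (f x + g x).
Proof.
move=> f0 g0.
set S := \int[mu]_x (f x + g x).
have fS : \int[mu]_x f x <= S by apply: le_integral_lower => x; rewrite leeDl.
have gS : \int[mu]_x g x <= S by apply: le_integral_lower => x; rewrite leeDr.
(* Once [S] is finite, so are the nonnegative integrals below it, and they may be moved across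
   inequalities. *)
have [->|Soo] := eqVneq S +oo; first by rewrite leey.
have Sfin a : 0 <= a -> a <= S -> a \is a fin_num.
  by move=> a0 aS; rewrite ge0_fin_numE// (le_lt_trans aS)// ltey.
have ff : \int[mu]_x f x \is a fin_num by apply: Sfin => //; exact: integral_ge0.
rewrite -leeBrDr//; last by apply: Sfin => //; exact: integral_ge0.
apply: ge0_integral_leP => // h hf.
have hfin : \int[mu]_x (h x)%:E \is a fin_num.
  apply: Sfin; first by apply: integral_ge0 => x _; rewrite lee_fin.
  by apply: le_trans fS; exact: nnsfun_integral_le.
rewrite leeBrDl; last by apply: Sfin => //; exact: integral_ge0.
rewrite -leeBrDr//.
apply: ge0_integral_leP => // k kg.
rewrite leeBrDl// -ge0_integralD//; first by apply: le_integral_lower => x; exact: leeD.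
- by move=> x _; rewrite lee_fin.
- exact/measurable_EFinP.
- by move=> x _; rewrite lee_fin.
- exact/measurable_EFinP.
Qed.

Lemma integral_abs_le u C : (forall x, `|u x| <= C x) ->
  \int[mu]_x u^\+ x <= \int[mu]_x C x /\ \int[mu]_x u^\- x <= \int[mu]_x C x.
Proof.
move=> uC; split; apply: le_integral_lower => x;
  apply: le_trans (uC x).
- by rewrite funeposE ge_max abse_ge0 lee_abs.
- by rewrite funenegE ge_max abse_ge0 -abseN lee_abs.
Qed.

Lemma abse_integral_le u C : (forall x, `|u x| <= C x) ->
  `|\int[mu]_x u x| <= \int[mu]_x C x.
Proof.
move=> uC; have [up un] := integral_abs_le uC.
rewrite integralE.
have p0 : 0 <= \int[mu]_x u^\+ x by apply: integral_ge0.
have n0 : 0 <= \int[mu]_x u^\- x by apply: integral_ge0.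
case: (\int[mu]_x u^\+ x) (\int[mu]_x u^\- x) (\int[mu]_x C x) p0 n0 up un
  => [p||] [n||] [I||] //=; rewrite ?leey ?lee_fin //.
by move=> p0 n0 pI nI; rewrite ler_norml; apply/andP; split; lra.
Qed.

(** For a simple [h] below [w], the function [h - C] is integrable and lies below [u], so additivity
    is only used on measurable functions. Where [C] is infinite, [h - C] is [-oo] and there is
    nothing to compare. *)
Lemma integral_le_add_dominating C u w :
  measurable_fun setT C -> (forall x, 0 <= C x) -> \int[mu]_x C x < +oo ->
  (forall x, 0 <= w x) -> (forall x, `|u x| <= C x) ->
  (forall x, C x < +oo -> w x <= u x + C x) ->
  \int[mu]_x w x <= \int[mu]_x u x + \int[mu]_x C x.
Proof.
move=> mC C0 iC w0 uC wuC.
have CI : mu.-integrable setT C.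
  apply/integrableP; split => //; apply: le_lt_trans iC.
  by apply: le_integral_lower => x; rewrite gee0_abs.
have Cfin : \int[mu]_x C x \is a fin_num.
  by rewrite ge0_fin_numE//; exact: integral_ge0.
apply: ge0_integral_leP => // h hw.
have mh : measurable_fun setT (EFin \o h) by exact/measurable_EFinP.
(* Domination by [2 C] makes [h] integrable, so that the integral of [h - C] splits. *)
have h2C x : (h x)%:E <= C x + C x.
  have [Coo|] := eqVneq (C x) +oo; first by rewrite Coo leey.
  rewrite -ltey => Clt.
  apply: (le_trans (hw x)); apply: (le_trans (wuC _ Clt)).
  by apply: leeD => //; apply: le_trans (uC x); rewrite lee_abs.
have hI : mu.-integrable setT (EFin \o h).
  apply: (le_integrable _ mh _ (integrableD _ CI CI)) => // x _.
  rewrite gee0_abs ?lee_fin// gee0_abs ?adde_ge0//.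
  exact: h2C.
rewrite -leeBlDr// -integralB//.
apply: le_integral_lower => x /=.
have [Coo|] := eqVneq (C x) +oo; first by rewrite Coo leNye.
rewrite -ltey => Clt.
rewrite leeBlDr; last by rewrite ge0_fin_numE.
by apply: (le_trans (hw x)); exact: wuC.
Qed.

(** The previous lemma applied to [- u]; the sign leaves the integral because both parts of [u] have
    finite integral. *)
Lemma integral_add_le_dominating C u w :
  measurable_fun setT C -> (forall x, 0 <= C x) -> \int[mu]_x C x < +oo ->
  (forall x, 0 <= w x) -> (forall x, `|u x| <= C x) ->
  (forall x, C x < +oo -> w x + u x <= C x) ->
  \int[mu]_x w x + \int[mu]_x u x <= \int[mu]_x C x.
Proof.
move=> mC C0 iC w0 uC wuC.
have [up un] := integral_abs_le uC.
have pf : \int[mu]_x u^\+ x \is a fin_num.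
  rewrite ge0_fin_numE ?(le_lt_trans up)//; exact: integral_ge0.
have nf : \int[mu]_x u^\- x \is a fin_num.
  rewrite ge0_fin_numE ?(le_lt_trans un)//; exact: integral_ge0.
have uf : \int[mu]_x u x \is a fin_num by rewrite integralE fin_numB pf nf.
have := @integral_le_add_dominating C (fun x => - u x) w mC C0 iC w0.
rewrite integralN; last by rewrite fin_num_adde_defl// fin_numN.
rewrite addeC leeBrDr//; apply.
- by move=> x; rewrite abseN.
- move=> x Clt; have Cf : C x \is a fin_num by rewrite ge0_fin_numE.
  have uf' : u x \is a fin_num.
    by rewrite fin_num_abs (le_lt_trans (uC x)).
  by rewrite addeC leeBrDr//; exact: wuC.
Qed.

End lower_integral.

(** * The iterated Lebesgue integral as a measure on Borel sets *)

Local Notation borelT R n := (g_sigma_algebraType (@open 'rV[R]_n)).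

Section borel_row.
Variable R : realType.

Lemma continuous_borel_measurable (n : nat) (f : 'rV[R]_n -> R) :
  continuous f -> measurable_fun setT (f : borelT R n -> R).
Proof.
move=> /continuousP cf; apply: (measurability _ (RGenOpens.measurableE R)).
move=> _ [_ [x [y ->]] <-]; rewrite setTI.
by apply: sub_sigma_algebra; apply: cf; exact: interval_open.
Qed.

Lemma measurable_coord (n : nat) (j : 'I_n) :
  measurable_fun setT (fun v : borelT R n => (v : 'rV[R]_n) ord0 j).
Proof. by apply: continuous_borel_measurable; exact: coord_continuous. Qed.

(* An open set is a countable union of rational boxes. *)
Lemma measurable_fun_row d (T : measurableType d) (n : nat) (g : T -> borelT R n) :
  (forall j : 'I_n, measurable_fun setT (fun t => (g t : 'rV[R]_n) ord0 j)) ->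
  measurable_fun setT g.
Proof.
move=> mg.
apply: (measurability _ (erefl _ : @measurable _ (borelT R n) = <<s @open 'rV[R]_n >>)).
move=> _ [U oU <-]; rewrite setTI.
pose box (k : 'rV[rat]_n * rat) : set 'rV[R]_n :=
  [set v | forall j, `|v ord0 j - ratr (k.1 ord0 j)| < ratr k.2].
have -> : g @^-1` U = \bigcup_(k in [set k | box k `<=` U]) (g @^-1` (box k)).
  apply/seteqP; split => t /=; last by move=> [k kU kt]; exact: kU.
  move=> Ut.
  have [e /= e0 eU] : exists2 e : R, 0 < e & ball (g t : 'rV[R]_n) e `<=` U.
    by apply/nbhs_ballP; exact: open_nbhs_nbhs.
  (* A box of radius less than [e / 2] that contains [g t] lies in the [e]-ball about it. *)
  have [q /andP[q0 qe]] : exists q : rat, 0 < (ratr q : R) < e / 2.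
    have [q qin] := @rat_in_itvoo R 0 (e / 2) ltac:(by rewrite divr_gt0).
    by exists q; move: qin; rewrite in_itv.
  have /choice [a ha] : forall j : 'I_n, exists a : rat,
      `|(g t : 'rV[R]_n) ord0 j - ratr a| < ratr q.
    move=> j; set x := (g t : 'rV[R]_n) ord0 j.
    have [a ain] := @rat_in_itvoo R (x - ratr q) (x + ratr q) ltac:(lra).
    by exists a; move: ain; rewrite in_itv /= => /andP[? ?];
      rewrite ltr_norml; apply/andP; split; lra.
  exists (\row_j a j, q) => /=; last by move=> j; rewrite mxE.
  move=> v hv; apply: eU; split => // i j; rewrite (ord1 i) -ball_normE /=.
  have := hv j; have := ha j; rewrite /= mxE => h1 h2.
  by apply: le_lt_trans (ler_distD (ratr (a j)) _ _) _; rewrite (distrC (ratr _)); lra.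
rewrite bigcup_mkcond.
apply: countable_bigcupT_measurable; first exact: countableP.
move=> k; case: ifP => _ //.
have -> : g @^-1` box k = \bigcap_(j in [set: 'I_n])
    ((fun t => (g t : 'rV[R]_n) ord0 j) @^-1`
      `](ratr (k.1 ord0 j) - ratr k.2), (ratr (k.1 ord0 j) + ratr k.2)[%classic).
  apply/seteqP; split => t /=.
    by move=> h j _; have := h j; rewrite /= in_itv /= ltr_distl.
  by move=> h j; have := h j I; rewrite /= in_itv /= ltr_distl.
apply: fin_bigcap_measurable; first exact: finite_finset.
move=> j _; rewrite -[X in measurable X]setTI.
by apply: mg => //; exact: measurable_itv.
Qed.

End borel_row.

Section lebint_measure.
Variable R : realType.

(** Uncurried onto the product sigma-algebra, so that the Tonelli theorem applies. *)
Definition rowcons_pair n (xv : measurableTypeR R * borelT R n) : borelT R n.+1 :=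
  rowcons xv.1 (xv.2 : 'rV[R]_n).

Lemma measurable_rowcons_pair n : measurable_fun setT (@rowcons_pair n).
Proof.
apply: measurable_fun_row => j.
case: (unliftP ord0 j) => [k ->|->].
  rewrite (_ : (fun t => _) =
      (fun v : borelT R n => (v : 'rV[R]_n) ord0 k) \o snd).
    by apply: measurableT_comp => //; exact: measurable_coord.
  by apply/funext => t /=; rewrite /rowcons_pair /rowcons mxE liftK.
rewrite (_ : (fun t => _) = fst) //.
by apply/funext => t /=; rewrite /rowcons_pair /rowcons mxE unlift_none.
Qed.

Let rowhead n (v : borelT R n.+1) : measurableTypeR R * borelT R n :=
  ((v : 'rV[R]_n.+1) ord0 ord0, \row_j (v : 'rV[R]_n.+1) ord0 (lift ord0 j)).

Let measurable_rowhead n : measurable_fun setT (@rowhead n).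
Proof.
apply: measurable_fun_pair; first exact: measurable_coord.
apply: measurable_fun_row => j.
rewrite (_ : (fun t => _) =
    fun v : borelT R n.+1 => (v : 'rV[R]_n.+1) ord0 (lift ord0 j)).
  exact: measurable_coord.
by apply/funext => v; rewrite mxE.
Qed.

Let rowconsK n : cancel (@rowcons_pair n) (@rowhead n).
Proof.
move=> [x v]; rewrite /rowhead /rowcons_pair /rowcons /= mxE unlift_none.
by congr pair; apply/rowP => j; rewrite !mxE liftK.
Qed.

Lemma measurable_rowcons n (x : R) :
  measurable_fun setT (fun v : borelT R n => rowcons x v : borelT R n.+1).
Proof.
exact: (measurableT_comp (@measurable_rowcons_pair n) (pair1_measurable (x : measurableTypeR R))).
Qed.

(** Induction on the dimension: a Dirac mass in dimension 0, then the image of the product of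
    one-dimensional Lebesgue measure with the previous measure. Tonelli peels off the first
    coordinate; sigma-finiteness is carried along because the product needs it. *)
Lemma lebint_measure n :
  exists mu : {sigma_finite_measure set (borelT R n) -> \bar R},
    forall f : borelT R n -> \bar R, (forall z, 0 <= f z)%E ->
      measurable_fun setT f -> lebint f = (\int[mu]_z f z)%E.
Proof.
elim: n => [|n [mu IH]].
  exists [the {sigma_finite_measure set _ -> \bar R} of
    @dirac _ (borelT R 0) (0 : 'rV[R]_0) R].
  by move=> f f0 mf /=; rewrite integral_dirac// diracT mul1e.
pose lm : {measure set _ -> \bar R} := ((@lebesgue_measure R) \x mu)%E.
pose m : {measure set (borelT R n.+1) -> \bar R} :=
  measure_function_pushforward__canonical__measure_function_Measure lm
    (@measurable_rowcons_pair n).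
have sm : sigma_finite setT m.
  have /sigma_finiteP[F [UF ndF HF]] := sigma_finiteT (@lebesgue_measure R).
  have /sigma_finiteP[G [UG ndG HG]] := sigma_finiteT mu.
  have mFG i : measurable (F i `*` G i).
    by apply: measurableX; [have [] := HF i|have [] := HG i].
  (* Products of the two exhaustions, transported by the inverse of [rowcons_pair]. Both exhaustions
     increase, so the larger of two indices serves for both factors. *)
  exists (fun i => @rowhead n @^-1` (F i `*` G i)).
    apply/esym; rewrite -subTset => v _.
    have [i _ Fi] : (\bigcup_i F i) (rowhead v).1 by rewrite -UF.
    have [j _ Gj] : (\bigcup_i G i) (rowhead v).2 by rewrite -UG.
    exists (maxn i j) => //; split.
    - by move: Fi; exact/subsetPset/ndF/leq_maxl.
    - by move: Gj; exact/subsetPset/ndG/leq_maxr.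
  move=> i; split.
    by rewrite -[X in measurable X]setTI; exact: (measurable_rowhead measurableT (mFG i)).
  rewrite /m /= /pushforward -comp_preimage (_ : _ \o _ = id); last first.
    by apply/funext => t /=; exact: rowconsK.
  have [mF Foo] := HF i; have [mG Goo] := HG i.
  by rewrite preimage_id product_measure1E// lte_mul_pinfty// ge0_fin_numE.
pose mix := Measure_isSigmaFinite.Build _ _ _ m sm.
exists (HB.pack_for (SigmaFiniteMeasure.type (borelT R n.+1) R) (Measure.sort m) mix).
move=> f f0 mf.
(* The packed structure has [m] as underlying measure, so the two integrals are convertible. *)
transitivity (\int[m]_z f z)%E; last by [].
have f0' : {in [set: borelT R n.+1], forall z, (0 <= f z)%E} by move=> z _; exact: f0.
have -> : (\int[m]_z f z = \int[lm]_t (f \o @rowcons_pair n) t)%E.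
  have := ge0_integral_pushforward (@measurable_rowcons_pair n) lm measurableT mf f0'.
  by rewrite preimage_setT.
rewrite fubini_tonelli1//=.
- apply: eq_integral => x _; rewrite IH//.
  by apply: measurableT_comp mf _; exact: measurable_rowcons.
- by apply: measurableT_comp mf _; exact: measurable_rowcons_pair.
Qed.
End lebint_measure.

(** * The iterated integral of non-measurable functions *)

Section lebint_theory.
Variable R : realType.

Definition lebmu n : {sigma_finite_measure set (borelT R n) -> \bar R} :=
  sval (cid (lebint_measure R n)).

Local Open Scope ereal_scope.

Lemma lebintE n (f : borelT R n -> \bar R) : (forall z, 0 <= f z) ->
  measurable_fun setT f -> lebint f = \int[lebmu n]_z f z.
Proof. by move=> f0 mf; rewrite /lebmu; case: cid => mu /= ->. Qed.

Lemma le_lebint n (f g : 'rV[R]_n -> \bar R) :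
  (forall z, f z <= g z) -> lebint f <= lebint g.
Proof.
elim: n f g => [|n IH] f g fg /=; first exact: fg.
by apply: le_integral_lower => x; apply: IH.
Qed.

Lemma lebint_ge0 n (f : 'rV[R]_n -> \bar R) :
  (forall z, 0 <= f z) -> 0 <= lebint f.
Proof.
elim: n f => [|n IH] f f0 /=; first exact: f0.
by apply: integral_ge0 => x _; apply: IH.
Qed.

Lemma abse_lebint_le n (u c : 'rV[R]_n -> \bar R) :
  (forall z, `|u z| <= c z) -> `|lebint u| <= lebint c.
Proof.
elim: n u c => [|n IH] u c uc /=; first exact: uc.
by apply: abse_integral_le => x; apply: IH.
Qed.

Lemma lebintZl_ge n (r : R) (f : 'rV[R]_n -> \bar R) :
  (0 <= r)%R -> (forall z, 0 <= f z) ->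
  r%:E * lebint f <= lebint (fun z => r%:E * f z).
Proof.
move=> r0; elim: n f => [|n IH] f f0 //=.
apply: le_trans (lower_integralZl_ge _ r0 _) _.
- by move=> x; exact: lebint_ge0.
- by apply: le_integral_lower => x; apply: IH.
Qed.

Lemma lebint_superadd n (f g : 'rV[R]_n -> \bar R) :
  (forall z, 0 <= f z) -> (forall z, 0 <= g z) ->
  lebint f + lebint g <= lebint (fun z => f z + g z).
Proof.
elim: n f g => [|n IH] f g f0 g0 //=.
apply: le_trans (integral_superadd _ _ _) _.
- by move=> x; exact: lebint_ge0.
- by move=> x; exact: lebint_ge0.
- by apply: le_integral_lower => x; apply: IH.
Qed.

Lemma lebint_sum_superadd n (I : Type) (r : seq I) (f : I -> 'rV[R]_n -> \bar R) :
  (forall i z, 0 <= f i z) ->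
  \sum_(i <- r) lebint (f i) <= lebint (fun z => \sum_(i <- r) f i z).
Proof.
move=> f0; elim: r => [|i r IH].
  by rewrite big_nil; apply: lebint_ge0 => z; rewrite big_nil.
rewrite big_cons; apply: le_trans (leeD (lexx _) IH) _.
apply: le_trans (lebint_superadd _ _) _ => //.
  by move=> z; apply: sume_ge0 => j _.
by apply: le_lebint => z; rewrite big_cons.
Qed.

(** Keeps the dominating function measurable after the inner integrations, as the one-dimensional
    comparison lemmas require. *)
Lemma measurable_lebint n (c : borelT R n.+1 -> \bar R) :
  (forall z, 0 <= c z) -> measurable_fun setT c ->
  measurable_fun setT
    (fun x : measurableTypeR R => lebint (fun v => c (rowcons x v))).
Proof.
move=> c0 mc.
have mcr : measurable_fun setT (c \o @rowcons_pair R n).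
  by apply: measurableT_comp mc _; exact: measurable_rowcons_pair.
rewrite (_ : (fun _ => _) = fubini_F (lebmu n) (c \o @rowcons_pair R n)).
  by apply: measurable_fun_fubini_tonelli_F => // z; exact: c0.
apply/funext => x; rewrite lebintE//.
by apply: measurableT_comp mc _; exact: measurable_rowcons.
Qed.

(** The induction hypothesis says nothing about slices on which [c] has infinite integral. This is
    why the one-dimensional lemma asks for its inequality only where the dominating function is
    finite. *)
Lemma lebint_le_add_dominating n (c u w : 'rV[R]_n -> \bar R) :
  measurable_fun setT (c : borelT R n -> \bar R) -> (forall z, 0 <= c z) ->
  lebint c < +oo -> (forall z, 0 <= w z) -> (forall z, `|u z| <= c z) ->
  (forall z, c z < +oo -> w z <= u z + c z) ->
  lebint w <= lebint u + lebint c.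
Proof.
elim: n c u w => [|n IH] c u w mc c0 ic w0 uc wuc /=; first exact: wuc.
apply: integral_le_add_dominating => //.
- exact: measurable_lebint.
- by move=> x; exact: lebint_ge0.
- by move=> x; exact: lebint_ge0.
- by move=> x; exact: abse_lebint_le.
- move=> x cx; apply: IH => //.
  + by apply: measurableT_comp mc _; exact: measurable_rowcons.
  + by move=> z; exact: wuc.
Qed.

Lemma lebint_add_le_dominating n (c u w : 'rV[R]_n -> \bar R) :
  measurable_fun setT (c : borelT R n -> \bar R) -> (forall z, 0 <= c z) ->
  lebint c < +oo -> (forall z, 0 <= w z) -> (forall z, `|u z| <= c z) ->
  (forall z, c z < +oo -> w z + u z <= c z) ->
  lebint w + lebint u <= lebint c.
Proof.
elim: n c u w => [|n IH] c u w mc c0 ic w0 uc wuc /=; first exact: wuc.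
apply: integral_add_le_dominating => //.
- exact: measurable_lebint.
- by move=> x; exact: lebint_ge0.
- by move=> x; exact: lebint_ge0.
- by move=> x; exact: abse_lebint_le.
- move=> x cx; apply: IH => //.
  + by apply: measurableT_comp mc _; exact: measurable_rowcons.
  + by move=> z; exact: wuc.
Qed.

End lebint_theory.

(** * Densities and pushforwards *)

Section densities.
Variable R : realType.
Implicit Types n : nat.

Lemma borel_funP n (f : 'rV[R]_n -> R) :
  borel_fun f <-> measurable_fun setT (f : borelT R n -> R).
Proof.
split=> [mf _ B mB|mf B mB]; first by rewrite setTI; exact: mf.
by rewrite -[f @^-1` B]setTI; exact: mf.
Qed.

Section prob_density.
Variables (n : nat) (q : 'rV[R]_n -> R).
Hypothesis dq : prob_density q.

Lemma prob_density_ge0 z : 0 <= q z. Proof. by case: dq. Qed.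

Lemma prob_density_measurable : measurable_fun setT (q : borelT R n -> R).
Proof. by case: dq => + _ _; exact: (borel_funP q).1. Qed.

Lemma prob_density_int1 : (\int[lebmu R n]_z (q z)%:E)%E = 1%E.
Proof.
rewrite -lebintE; first by case: dq.
- by move=> z; rewrite lee_fin prob_density_ge0.
- by apply/measurable_EFinP; exact: prob_density_measurable.
Qed.

Lemma prob_density_integrable : (lebmu R n).-integrable setT (fun z : borelT R n => (q z)%:E).
Proof.
apply/integrableP; split; first by apply/measurable_EFinP; exact: prob_density_measurable.
rewrite (eq_integral (fun z : borelT R n => (q z)%:E)).
  by rewrite prob_density_int1 ltry.
by move=> z _; rewrite /= ger0_norm// prob_density_ge0.
Qed.

Lemma integrable_bounded_density (f : 'rV[R]_n -> R) M :
  measurable_fun setT (f : borelT R n -> R) -> (forall z, `|f z| <= M) ->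
  (lebmu R n).-integrable setT (fun z : borelT R n => (f z * q z)%:E).
Proof.
move=> mf fM.
apply: (@le_integrable _ _ _ _ _ measurableT _ (fun z : borelT R n => M%:E * (q z)%:E)%E).
- apply/measurable_EFinP/measurable_funM => //; exact: prob_density_measurable.
- move=> z _; rewrite /= lee_fin !normrM ler_wpM2r// (le_trans (fM z))//.
  exact: ler_norm.
- by apply: integrableZl => //; exact: prob_density_integrable.
Qed.

Lemma integral_indic_density (B : set 'rV[R]_n) : borelRd B ->
  lebint (fun z => (\1_B z * q z)%:E) = (\int[lebmu R n]_z (\1_B z * q z)%:E)%E.
Proof.
move=> bB; apply: lebintE.
- by move=> z; rewrite lee_fin mulr_ge0// prob_density_ge0.
- apply/measurable_EFinP/measurable_funM; last exact: prob_density_measurable.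
  by apply: measurable_indic.
Qed.

End prob_density.

(** Uniqueness for the continuity equation is given as vanishing L1 distance; this turns it into
    equal masses of Borel sets, through [1_B q1 <= 1_B q2 + |q1 - q2|] and its mirror image. *)
Lemma eq_indic_density n (q1 q2 : 'rV[R]_n -> R) :
  prob_density q1 -> prob_density q2 ->
  lebint (fun z => (`|q1 z - q2 z|)%:E) = 0%E ->
  forall B, borelRd B ->
    lebint (fun z => (\1_B z * q1 z)%:E) = lebint (fun z => (\1_B z * q2 z)%:E).
Proof.
move=> d1 d2 h B bB.
have le a b : prob_density a -> prob_density b ->
    lebint (fun z => (`|a z - b z|)%:E) = 0%E ->
    (lebint (fun z => (\1_B z * a z)%:E) <= lebint (fun z => (\1_B z * b z)%:E))%E.
  move=> da db ab0.
  have mB : measurable_fun setT (\1_B : borelT R n -> R) by exact: measurable_indic.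
  have ma := prob_density_measurable da; have mb := prob_density_measurable db.
  have mab : measurable_fun setT (fun z : borelT R n => `|a z - b z|).
    by apply: measurableT_comp => //; exact: measurable_funB.
  rewrite !integral_indic_density// -[leRHS]adde0 -ab0.
  have -> : (lebint (fun z => (`|a z - b z|)%:E) = \int[lebmu R n]_z (`|a z - b z|)%:E)%E.
    by apply: lebintE; [move=> z; rewrite lee_fin|exact/measurable_EFinP].
  rewrite -ge0_integralD//.
  - apply: le_integral_lower => z.
    rewrite -EFinD lee_fin indicE; case: (z \in B) => /=.
      by rewrite !mul1r; have := ler_norm (a z - b z); lra.
    by rewrite !mul0r add0r.
  - by move=> z _; rewrite lee_fin mulr_ge0// prob_density_ge0.
  - by apply/measurable_EFinP; exact: measurable_funM.
  - exact/measurable_EFinP.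
apply/le_anti/andP; split; apply: le => //.
by rewrite -[RHS]h; congr lebint; apply/funext => z; rewrite distrC.
Qed.

Section pushforward.
Variables (n : nat) (phi : 'rV[R]_n -> 'rV[R]_n) (rho q : 'rV[R]_n -> R).
Hypotheses (drho : prob_density rho) (dq : prob_density q).
Hypothesis phiq : pushforward_has_density phi rho q.

Import HBNNSimple.

(** The hypothesis gives the mass of the preimage of each level set of [g]; superadditivity
    reassembles the levels, hence only an inequality. *)
Lemma lebint_pushforward_ge_nnsfun (g : {nnsfun (borelT R n) >-> R}) :
  (\int[lebmu R n]_z (g z * q z)%:E <= lebint (fun x => (g (phi x) * rho x)%:E))%E.
Proof.
pose B y : set 'rV[R]_n := g @^-1` [set y].
have mB y : borelRd (B y).
  by have := @measurable_funP _ _ _ _ setT g measurableT [set y]; rewrite setTI; apply.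
have gE z : g z = \sum_(y <- fset_set (range g)) y * \1_(B y) z.
  by rewrite fimfunE fsbig_finite//.
have term_ge0 (h : 'rV[R]_n -> R) z' y z : 0 <= h z ->
   (0 <= (y * \1_(B y) z' * h z)%:E)%E.
  move=> h0; rewrite lee_fin mulr_ge0//.
  by rewrite -lee_fin EFinM; exact: nnfun_muleindic_ge0.
rewrite (eq_integral (fun z : borelT R n =>
    \sum_(y <- fset_set (range g)) (y * \1_(B y) z * q z)%:E)%E); last first.
  by move=> z _; rewrite gE sumEFin -mulr_suml.
rewrite ge0_integral_sum//; last 2 first.
- move=> y; apply/measurable_EFinP; apply: measurable_funM; last exact: prob_density_measurable.
  by apply: measurable_funM => //; apply: measurable_indic; exact: mB.
- by move=> y z _; apply: term_ge0; exact: prob_density_ge0.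
apply: (@le_trans _ _ (\sum_(y <- fset_set (range g))
    lebint (fun x => (y * \1_(B y) (phi x) * rho x)%:E))%E).
  apply: lee_sum => y _.
  (* Membership of [y] in the range is lost in the termwise comparison; for negative [y] the level
     set is empty since [g] is nonnegative. *)
  have [y0|y0] := leP 0 y; last first.
    rewrite integral0_eq; first by apply: lebint_ge0 => x; apply: term_ge0; exact: prob_density_ge0.
    move=> z _; rewrite indicE.
    case: (boolP (z \in B y)) => [|_]; last by rewrite mulr0 mul0r.
    by move=> /set_mem; rewrite /B /= => gzy; move: y0; rewrite -gzy ltNge fun_ge0.
  rewrite (eq_integral (fun z : borelT R n => y%:E * (\1_(B y) z * q z)%:E)%E); last first.
    by move=> z _; rewrite -EFinM mulrA.
  rewrite ge0_integralZl_EFin//; last 2 first.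
  - by move=> z _; rewrite lee_fin mulr_ge0// prob_density_ge0.
  - apply/measurable_EFinP; apply: measurable_funM; last exact: prob_density_measurable.
    by apply: measurable_indic; exact: mB.
  rewrite -integral_indic_density// -phiq//.
  apply: le_trans (lebintZl_ge y0 _) _.
    by move=> x; rewrite lee_fin mulr_ge0// prob_density_ge0.
  by apply: le_lebint => x; rewrite -EFinM mulrA.
apply: le_trans (lebint_sum_superadd _ _) _.
  by move=> y x; apply: term_ge0; exact: prob_density_ge0.
by apply: le_lebint => x; rewrite gE sumEFin -mulr_suml.
Qed.

(** Simple functions increase to [a]. Monotone convergence is applied only on the measurable side;
    on the side of [phi], monotonicity bounds every approximation by [a]. *)
Lemma lebint_pushforward_ge (a : 'rV[R]_n -> R) :
  measurable_fun setT (a : borelT R n -> R) -> (forall z, 0 <= a z) ->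
  (\int[lebmu R n]_z (a z * q z)%:E <= lebint (fun x => (a (phi x) * rho x)%:E))%E.
Proof.
move=> ma a0.
have mEa : measurable_fun setT (EFin \o (a : borelT R n -> R)) by exact/measurable_EFinP.
pose g := nnsfun_approx measurableT mEa.
have ga z : (EFin \o g^~ z) @ \oo --> (a z)%:E.
  by apply: (cvg_nnsfun_approx measurableT mEa) => // x _; rewrite lee_fin.
have nd z m k : (m <= k)%N -> g m z <= g k z.
  by move=> mk; have /lefP := nd_nnsfun_approx measurableT mEa mk; exact.
have gqa z : (fun k => (g k z * q z)%:E) @ \oo --> (a z * q z)%:E.
  under eq_fun do rewrite EFinM.
  by rewrite EFinM; apply: cvgeZr => //; exact: ga.
have -> : (\int[lebmu R n]_z (a z * q z)%:E =
    \int[lebmu R n]_z limn (fun k => (g k z * q z)%:E))%E.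
  by apply: eq_integral => z _; apply/esym/cvg_lim => //; exact: gqa.
have mgq k : measurable_fun setT (fun z : borelT R n => (g k z * q z)%:E).
  by apply/measurable_EFinP; apply: measurable_funM => //; exact: prob_density_measurable.
have gq0 k z : (0 <= (g k z * q z)%:E)%E by rewrite lee_fin mulr_ge0// prob_density_ge0.
have ndgq z : {homo (fun k => (g k z * q z)%:E) : m k / (m <= k)%N >-> (m <= k)%E}.
  by move=> m k mk; rewrite lee_fin ler_wpM2r ?prob_density_ge0// nd.
rewrite monotone_convergence//.
apply: lime_le.
  apply: ereal_nondecreasing_is_cvgn => m k mk.
  by apply: le_integral_lower => z; exact: ndgq.
apply: nearW => k; apply: le_trans (lebint_pushforward_ge_nnsfun _) _.
apply: le_lebint => x; rewrite lee_fin ler_wpM2r ?prob_density_ge0//.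
rewrite -lee_fin -(cvg_lim _ (ga (phi x)))//.
apply: lime_ge; first exact: cvgP (ga (phi x)).
by exists k => // m /= km; rewrite lee_fin nd.
Qed.

End pushforward.
End densities.

Section pushforward_integral.
Variables (R : realType) (n : nat) (phi : 'rV[R]_n -> 'rV[R]_n).
Variables (rho q : 'rV[R]_n -> R).
Hypotheses (drho : prob_density rho) (dq : prob_density q).
Hypothesis phiq : pushforward_has_density phi rho q.

(* [phi] is not assumed measurable, so [lebint] on the left is only an iterated
   lower integral; comparing [f o phi] with [M + f o phi] and [M - f o phi]
   squeezes it. *)
Lemma lebint_pushforward (f : 'rV[R]_n -> R) M :
  measurable_fun setT (f : borelT R n -> R) -> (forall z, `|f z| <= M) ->
  lebint (fun x => (f (phi x) * rho x)%:E) =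
  (\int[lebmu R n]_z (f z * q z)%:E)%E.
Proof.
move=> mf fM.
have rho0 := prob_density_ge0 drho; have q0 := prob_density_ge0 dq.
have M0 : 0 <= M by exact: le_trans (normr_ge0 _) (fM 0).
have iq := prob_density_integrable dq.
have ifq := integrable_bounded_density dq mf fM.
have Jfin : (\int[lebmu R n]_z (f z * q z)%:E)%E \is a fin_num.
  exact: integrable_fin_num.
have mc : measurable_fun setT (fun z : borelT R n => (M * rho z)%:E).
  apply/measurable_EFinP; apply: measurable_funM => //.
  exact: prob_density_measurable.
have lc : lebint (fun z => (M * rho z)%:E) = M%:E.
  rewrite lebintE//; last by move=> z; rewrite lee_fin mulr_ge0// M0.
  under eq_integral do rewrite EFinM.
  rewrite ge0_integralZl_EFin ?prob_density_int1 ?mule1//.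
  - by move=> z _; rewrite lee_fin.
  - by apply/measurable_EFinP; exact: prob_density_measurable.
have lc_lty : (lebint (fun z => (M * rho z)%:E) < +oo)%E by rewrite lc ltry.
have fMb z : - M <= f z <= M by rewrite -ler_norml.
have uc z : (`|(f (phi z) * rho z)%:E| <= (M * rho z)%:E)%E.
  by rewrite abse_EFin lee_fin normrM (ger0_norm (rho0 z)) ler_wpM2r.
have up : (M%:E + \int[lebmu R n]_z (f z * q z)%:E <=
    lebint (fun x => ((M + f (phi x)) * rho x)%:E))%E.
  apply: (le_trans _ (@lebint_pushforward_ge _ _ phi rho q drho dq phiq (fun z => M + f z) _ _)).
  - rewrite -[M%:E]mule1 -(prob_density_int1 dq) -integralZl// -integralD//.
      by apply: le_integral_lower => z; rewrite -EFinM -EFinD mulrDl.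
    exact: integrableZl.
  - exact: measurable_funD.
  - by move=> z; have := fMb z; lra.
have dn : (M%:E - \int[lebmu R n]_z (f z * q z)%:E <=
    lebint (fun x => ((M - f (phi x)) * rho x)%:E))%E.
  apply: (le_trans _ (@lebint_pushforward_ge _ _ phi rho q drho dq phiq (fun z => M - f z) _ _)).
  - rewrite -[M%:E]mule1 -(prob_density_int1 dq) -integralZl// -integralB//.
      by apply: le_integral_lower => z; rewrite -EFinM -EFinB mulrBl.
    exact: integrableZl.
  - exact: measurable_funB.
  - by move=> z; have := fMb z; lra.
(* [up'] and [dn'] bound the lower integrals of [M + f o phi] and [M - f o phi] from above by [M]
   plus, respectively minus, that of [f o phi]. Against the lower bounds [up] and [dn] this leaves a
   single value. *)
have up' := lebint_le_add_dominating
  (w := fun x => ((M + f (phi x)) * rho x)%:E) mc _ lc_lty _ uc _.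
have dn' := lebint_add_le_dominating
  (w := fun x => ((M - f (phi x)) * rho x)%:E) mc _ lc_lty _ uc _.
move: Jfin up dn; set J := (\int[lebmu R n]_z (f z * q z)%:E)%E => Jfin up dn.
apply/le_anti/andP; split.
- rewrite -(leeD2lE (x := (M%:E - J)%E)); last by rewrite fin_numB Jfin.
  rewrite subeK//; apply: le_trans (leeD dn (lexx _)) _.
  rewrite -lc; apply: dn' => z.
  + by rewrite lee_fin mulr_ge0.
  + by rewrite lee_fin mulr_ge0//; have := fMb (phi z); lra.
  + by move=> _; rewrite -EFinD lee_fin -mulrDl subrK.
- rewrite -(leeD2lE (x := M%:E))//; apply: le_trans up _; rewrite addeC.
  rewrite -lc; apply: up' => z.
  + by rewrite lee_fin mulr_ge0.
  + by rewrite lee_fin mulr_ge0//; have := fMb (phi z); lra.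
  + by move=> _; rewrite -EFinD lee_fin -mulrDl addrC.
Qed.

End pushforward_integral.

(** * Mixtures of solutions of the continuity equation *)

Section mixtures.
Variables (R : realType) (d N : nat) (w : 'I_N -> R).
Hypothesis w1 : \sum_(n < N) w n = 1.

Lemma prob_density_mixture (p : 'I_N -> 'rV[R]_d -> R) :
  (forall n, 0 <= w n) -> (forall n, prob_density (p n)) ->
  prob_density (fun z => \sum_(n < N) w n * p n z).
Proof.
move=> w0 dp.
have mp n : measurable_fun setT (fun z : borelT R d => w n * p n z).
  by apply: measurable_funM => //; exact: prob_density_measurable.
have p0 n z : 0 <= w n * p n z by rewrite mulr_ge0// (prob_density_ge0 (dp n)).
have mmix : measurable_fun setT (fun z : borelT R d => \sum_(n < N) w n * p n z).
  exact: measurable_sum.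
split.
- exact/borel_funP.
- by move=> z; apply: sumr_ge0.
- rewrite lebintE; last 2 first.
  + by move=> z; rewrite lee_fin sumr_ge0.
  + exact/measurable_EFinP.
  under eq_integral do rewrite -sumEFin.
  rewrite ge0_integral_sum//.
  + rewrite -[RHS]/((1 : R)%:E) -w1 -sumEFin; apply: eq_bigr => n _.
    under eq_integral do rewrite EFinM.
    rewrite ge0_integralZl_EFin ?prob_density_int1 ?mule1//.
    * by move=> z _; rewrite lee_fin (prob_density_ge0 (dp n)).
    * by apply/measurable_EFinP; exact: prob_density_measurable.
  + by move=> n; apply/measurable_EFinP.
  + by move=> n z _; rewrite lee_fin.
Qed.

Lemma integral_mixture (p : 'I_N -> 'rV[R]_d -> R) (f : 'rV[R]_d -> R) M :
  (forall n, prob_density (p n)) ->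
  measurable_fun setT (f : borelT R d -> R) -> (forall z, `|f z| <= M) ->
  (\int[lebmu R d]_z (f z * \sum_(n < N) w n * p n z)%:E)%E =
  (\sum_(n < N) w n * fine (\int[lebmu R d]_z (f z * p n z)%:E))%:E.
Proof.
move=> dp mf fM.
have ifp n := integrable_bounded_density (dp n) mf fM.
rewrite (eq_integral (fun z : borelT R d =>
    \sum_(n < N) (w n)%:E * (f z * p n z)%:E)%E); last first.
  move=> z _; rewrite mulr_sumr -sumEFin; apply: eq_bigr => n _.
  by rewrite -EFinM mulrCA.
rewrite integral_sum//; last by move=> n; exact: integrableZl.
rewrite -sumEFin; apply: eq_bigr => n _.
by rewrite integralZl// EFinM fineK//; exact: integrable_fin_num.
Qed.

(** Both sides of the equation are linear in the pair of density and flux, and the common initial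
    density survives because the weights sum to one. *)
Lemma solves_CE_mixture (p : 'I_N -> R -> 'rV[R]_d -> R)
    (u : 'I_N -> R -> 'rV[R]_d -> 'rV[R]_d) (v : R -> 'rV[R]_d -> 'rV[R]_d)
    (q0 : 'rV[R]_d -> R) :
  (forall n, solves_CE (p n) (u n) q0) ->
  (forall t z, (\sum_(n < N) w n * p n t z) *: v t z =
     \sum_(n < N) w n *: (p n t z *: u n t z)) ->
  solves_CE (fun t z => \sum_(n < N) w n * p n t z) v q0.
Proof.
move=> ce flux; split.
- move=> z; under eq_bigr => n _ do (have [-> _ _] := ce n).
  by rewrite -mulr_suml w1 mul1r.
- move=> z x; apply: cvg_big => [|n _].
    exact: add_continuous.
  apply: cvgM; first exact: cvg_cst.
  by have [_ + _] := ce n; exact.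
- move=> t t01 z.
  have ds n : is_derive t 1 (fun s => p n s z) ('D_1 (fun s => p n s z) t).
    by apply: derivableP; have [_ _ /(_ t t01 z)[]] := ce n.
  have dsum : is_derive t 1 (fun s => \sum_(n < N) w n * p n s z)
      (\sum_(n < N) w n *: 'D_1 (fun s => p n s z) t).
    rewrite (_ : (fun s => _) = \sum_(n < N) (w n \*: (fun s => p n s z))); last first.
      by rewrite fct_sumE.
    by apply: is_derive_sum => n; exact: is_deriveZ.
  have dF i : is_derive z (basis_vec R i)
      (fun z' => (\sum_(n < N) w n * p n t z') *: v t z')
      (\sum_(n < N) w n *: 'D_(basis_vec R i) (fun z' => p n t z' *: u n t z') z).
    (* The flux identity is used before differentiating, so no derivative of [v] itself is taken. *)
    rewrite (_ : (fun z' => _) =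
        \sum_(n < N) (w n \*: (fun z' => p n t z' *: u n t z'))); last first.
      by rewrite fct_sumE; apply/funext => z'; rewrite flux.
    apply: is_derive_sum => n; apply: is_deriveZ; apply: derivableP.
    by have [_ _ /(_ t t01 z)[_ + _]] := ce n; exact.
  split.
  + exact: ex_derive.
  + by move=> i; have := dF i => ?; exact: ex_derive.
  + rewrite derive_val /divergence.
    under [in RHS]eq_bigr => i _ do (have dFi := dF i;
      rewrite (@derive_val _ _ _ _ _ _ _ dFi) summxE).
    rewrite exchange_big /= -sumrN; apply: eq_bigr => n _.
    have [_ _ /(_ t t01 z)[_ _ ->]] := ce n.
    rewrite /divergence scalerN; congr (- _).
    rewrite [LHS]mulr_sumr; apply: eq_bigr => i _.
    by rewrite mxE.
Qed.

End mixtures.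

(** * Concentration of Gaussians *)

Section gaussian.
Variables (R : realType) (d : nat).

(** The exponent is split into two equal halves: one belongs to the Gaussian of variance [2 s^2],
    and [Num.sqrt 2 ^+ d] is the ratio of the normalizing constants. *)
Lemma gauss_scale (m : 'rV[R]_d) s z : 0 < s ->
  gauss m s z =
  Num.sqrt 2 ^+ d * expR (- (sqnorm (z - m) / (4 * s ^+ 2))) * gauss m (Num.sqrt 2 * s) z.
Proof.
move=> s0; rewrite /gauss.
have s2 : Num.sqrt 2 ^+ 2 = 2 :> R by rewrite sqr_sqrtr.
have -> : 2 * pi * (Num.sqrt 2 * s) ^+ 2 = 2 * (2 * pi * s ^+ 2) :> R.
  by rewrite exprMn s2; ring.
rewrite [Num.sqrt (2 * (2 * pi * s ^+ 2))]sqrtrM//.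
rewrite [(Num.sqrt 2 * s) ^+ 2]exprMn [(Num.sqrt 2 * _) ^+ d]exprMn s2.
set K := Num.sqrt 2 ^+ d; set A := Num.sqrt (2 * pi * _) ^+ d; set r := sqnorm _.
have K0 : K != 0 by rewrite expf_neq0// sqrtr_eq0 -ltNge.
have A0 : A != 0.
  by rewrite expf_neq0// sqrtr_eq0 -ltNge !mulr_gt0// ?pi_gt0// exprn_gt0.
rewrite (_ : - r / (2 * s ^+ 2) = - (r / (4 * s ^+ 2)) + - r / (2 * (2 * s ^+ 2))).
  by rewrite expRD; field; rewrite A0 K0.
by field; rewrite gt_eqF.
Qed.

Lemma expRN_le (x : R) : 0 < x -> expR (- x) <= x^-1.
Proof.
move=> x0; rewrite expRN lef_pV2 ?posrE ?expR_gt0//.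
by have := expR_ge1Dx x; lra.
Qed.

(* Off the ball of radius [e] about [m], comparison with the wider Gaussian of
   variance [2 s^2] gains the factor [exp (- e^2 / (4 s^2))]; this bounds the
   tail mass without computing any moment. *)
Lemma gauss_tail_le (m : 'rV[R]_d) s e z : 0 < s -> 0 < e ->
  e ^+ 2 <= sqnorm (z - m) ->
  gauss m s z <=
  Num.sqrt 2 ^+ d * (4 * s ^+ 2 / e ^+ 2) * gauss m (Num.sqrt 2 * s) z.
Proof.
move=> s0 e0 ez; rewrite gauss_scale//.
have G0 : 0 <= gauss m (Num.sqrt 2 * s) z.
  by rewrite /gauss mulr_ge0// ?expR_ge0// invr_ge0 exprn_ge0// sqrtr_ge0.
rewrite ler_wpM2r// ler_wpM2l ?exprn_ge0 ?sqrtr_ge0//.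
have s20 : 0 < 4 * s ^+ 2 by rewrite mulr_gt0// exprn_gt0.
have e20 : 0 < e ^+ 2 by rewrite exprn_gt0.
apply: (@le_trans _ _ (expR (- (e ^+ 2 / (4 * s ^+ 2))))).
  by rewrite ler_expR lerN2 ler_pM2r// invr_gt0.
by rewrite -[leRHS]invf_div expRN_le// divr_gt0.
Qed.

(** Balls of row vectors are taken in the sup norm, and each squared coordinate is at most the
    squared Euclidean norm. *)
Lemma ball_sqnorm (m z : 'rV[R]_d) (e : R) : 0 < e -> sqnorm (z - m) < e ^+ 2 ->
  ball m e z.
Proof.
move=> e0 h; split => // i j; rewrite (ord1 i) -ball_normE /= distrC.
rewrite -(ltr_pXn2r (n := 2))// ?nnegrE ?ltW// real_normK ?num_real//.
apply: le_lt_trans h; rewrite /sqnorm (bigD1 j)//= !mxE lerDl.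
by apply: sumr_ge0 => k _; exact: sqr_ge0.
Qed.

(** No Gaussian integral is computed: the density hypothesis supplies mass one at both scales [s]
    and [Num.sqrt 2 * s]. *)
Lemma cvg_gauss_integral (m : 'rV[R]_d) (f : 'rV[R]_d -> R) M :
  (forall s, 0 < s -> prob_density (gauss m s)) ->
  continuous f -> (forall z, `|f z| <= M) ->
  (fun s => fine (\int[lebmu R d]_z (f z * gauss m s z)%:E)%E) @ 0^'+ --> f m.
Proof.
move=> dg cf fM; apply/cvgrPdist_le => eps eps0.
have mf := continuous_borel_measurable cf.
have M0 : 0 <= M by exact: le_trans (fM 0).
have e20 : 0 < eps / 2 by rewrite divr_gt0.
have [e /= e0 ef] : exists2 e : R, 0 < e & ball m e `<=` [set z | `|f m - f z| < eps / 2].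
  by apply/nbhs_ballP; move/cvgrPdist_lt : (cf m) => /(_ _ e20).
pose K := Num.sqrt (2 : R) ^+ d.
have K0 : 0 <= K by rewrite exprn_ge0// sqrtr_ge0.
have Q0 s : 0 <= 4 * s ^+ 2 / e ^+ 2.
  by apply: divr_ge0; [apply: mulr_ge0; [exact: ler0n|exact: sqr_ge0]|exact: sqr_ge0].
(* Continuity gives the first term inside the Euclidean [e]-ball; outside it, the tail bound and
   [|f z - f m| <= 2 M] give the second. *)
have pt s z : 0 < s -> `|f z - f m| * gauss m s z <=
    eps / 2 * gauss m s z +
    2 * M * (K * (4 * s ^+ 2 / e ^+ 2)) * gauss m (Num.sqrt 2 * s) z.
  move=> s0.
  have ss0 : 0 < Num.sqrt 2 * s by rewrite mulr_gt0// sqrtr_gt0.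
  have g0 := prob_density_ge0 (dg _ s0) z.
  have g0' := prob_density_ge0 (dg _ ss0) z.
  have [zm|zm] := ltP (sqnorm (z - m)) (e ^+ 2).
    have := ef z (ball_sqnorm e0 zm); rewrite /= distrC => /ltW fz.
    apply: ler_wpDr; last exact: ler_wpM2r.
    by apply: mulr_ge0 => //; apply: mulr_ge0; apply: mulr_ge0.
  apply: ler_wpDl; first by rewrite mulr_ge0// ltW.
  rewrite -[leRHS]mulrA; apply: ler_pM => //.
    by have := ler_normB (f z) (f m); have := fM z; have := fM m; lra.
  exact: gauss_tail_le.
near=> s.
have s0 : 0 < s by near: s; exact: nbhs_right_gt.
have ss0 : 0 < Num.sqrt 2 * s by rewrite mulr_gt0// sqrtr_gt0.
have s1 : s < 1 by near: s; exact: nbhs_right_lt.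
(* Chosen so that [8 M K s^2 / e^2 <= eps / 2], using [s^2 <= s]; the [+ 1] keeps the denominator
   positive when [M] is zero. *)
have sc : s < eps * e ^+ 2 / (16 * (M * K + 1)).
  near: s; apply: nbhs_right_lt; rewrite divr_gt0// ?mulr_gt0 ?exprn_gt0//.
  by have := mulr_ge0 M0 K0; lra.
have Cle : 2 * M * (K * (4 * s ^+ 2 / e ^+ 2)) <= eps / 2.
  have e2 : 0 < e ^+ 2 by rewrite exprn_gt0.
  have MK0 := mulr_ge0 M0 K0.
  have ss : s ^+ 2 <= s by rewrite expr2 ler_piMl ?ltW.
  rewrite (_ : _ * _ = 8 * (M * K) * s ^+ 2 / e ^+ 2); last by field; rewrite gt_eqF.
  rewrite ler_pdivrMr//.
  move: sc; rewrite ltr_pdivlMr; last by lra.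
  move: (e ^+ 2) (s ^+ 2) (M * K) e2 ss MK0 => E S T E0 SS T0 sc.
  by nra.
have dgs := dg _ s0; have dgs' := dg _ ss0.
have ifg := integrable_bounded_density dgs mf fM.
have ig := prob_density_integrable dgs; have ig' := prob_density_integrable dgs'.
set C := 2 * M * _ in Cle pt.
rewrite -lee_fin -abse_EFin EFinB fineK; last exact: integrable_fin_num.
rewrite -[(f m)%:E]mule1 -(prob_density_int1 dgs) -integralZl// -integralB//;
  last exact: integrableZl.
apply: (@le_trans _ _ (\int[lebmu R d]_z
    ((eps / 2)%:E * (gauss m s z)%:E + C%:E * (gauss m (Num.sqrt 2 * s) z)%:E))%E).
  apply: abse_integral_le => z.
  rewrite -!EFinM -EFinB -EFinD abse_EFin lee_fin -mulrBl normrM distrC.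
  by rewrite (ger0_norm (prob_density_ge0 dgs z)); exact: pt.
rewrite integralD//; [|exact: integrableZl|exact: integrableZl].
rewrite !integralZl// (prob_density_int1 dgs) (prob_density_int1 dgs') !mule1.
by rewrite -EFinD lee_fin; lra.
Unshelve. all: by end_near. Qed.

End gaussian.

(** * Monte-Carlo guidance *)

Section monte_carlo_guidance.
Variable R : realType.

Lemma sumr_ord_gt0 N (F : 'I_N -> R) :
  (0 < N)%N -> (forall n, 0 < F n) -> 0 < \sum_(n < N) F n.
Proof.
case: N F => // N F _ F0; rewrite big_ord_recl ltr_wpDr//.
by apply: sumr_ge0 => n _; exact: ltW.
Qed.

Variables (N d : nat) (L : 'rV[R]_d -> R) (xhat z0 : 'I_N -> 'rV[R]_d).
Hypotheses (N0 : (0 < N)%N) (L0 : forall x, 0 < L x).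

Lemma lik_weight_ge0 n : 0 <= lik_weight L xhat n.
Proof. by rewrite divr_ge0// ltW// sumr_ord_gt0. Qed.

Lemma sum_lik_weight : \sum_(n < N) lik_weight L xhat n = 1.
Proof. by rewrite -mulr_suml divff// gt_eqF// sumr_ord_gt0. Qed.

(** The mixture density is [T / S], where [T] is the denominator of the guided weights;
    multiplication by it cancels [T] and leaves the likelihood weights. *)
Lemma u_MCG_flux p u t z : (forall n, 0 < p t z (z0 n) (xhat n)) ->
  (\sum_(n < N) lik_weight L xhat n * p t z (z0 n) (xhat n)) *:
    u_MCG L p u z0 xhat t z =
  \sum_(n < N) lik_weight L xhat n *:
    (p t z (z0 n) (xhat n) *: u t z (z0 n) (xhat n)).
Proof.
move=> p0; rewrite /u_MCG /lik_weight.
set S := \sum_(m < N) L (xhat m).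
set T := \sum_(m < N) L (xhat m) * p t z (z0 m) (xhat m).
have S0 : S != 0 by rewrite gt_eqF// sumr_ord_gt0.
have T0 : T != 0 by rewrite gt_eqF// sumr_ord_gt0// => n; exact: mulr_gt0.
have -> : \sum_(n < N) L (xhat n) / S * p t z (z0 n) (xhat n) = T / S.
  by rewrite mulr_suml; apply: eq_bigr => n _; rewrite mulrAC.
rewrite scaler_sumr; apply: eq_bigr => n _; rewrite !scalerA; congr (_ *: _).
by field; rewrite S0 T0.
Qed.

End monte_carlo_guidance.

Theorem theorem4p3 (R : realType) (d N : nat) (Y : Type)
    (lik : Y -> 'rV[R]_d -> R) (y : Y)
    (rho0 : 'rV[R]_d -> R) (xhat z0 : 'I_N -> 'rV[R]_d)
    (p : R -> R -> 'rV[R]_d -> 'rV[R]_d -> 'rV[R]_d -> R)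
    (u : R -> R -> 'rV[R]_d -> 'rV[R]_d -> 'rV[R]_d -> 'rV[R]_d)
    (phi : R -> R -> 'rV[R]_d -> 'rV[R]_d) :
  (0 < N)%N ->
  prob_density rho0 ->
  (forall x, 0 < lik y x) ->
  (forall s, 0 < s -> forall a b,
      density_path (fun t z => p s t z a b) /\
      solves_CE (fun t z => p s t z a b) (fun t z => u s t z a b) rho0) ->
  (forall s, 0 < s -> forall a b z, p s 1 z a b = gauss b s z) ->
  (forall s, 0 < s -> forall t z (n : 'I_N), 0 < p s t z (z0 n) (xhat n)) ->
  (forall s, 0 < s -> is_flow (u_MCG (lik y) (p s) (u s) z0 xhat) (phi s)) ->
  (forall s, 0 < s -> exists qs : R -> 'rV[R]_d -> R,
      [/\ density_path qs,
          solves_CE qs (u_MCG (lik y) (p s) (u s) z0 xhat) rho0,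
          (forall t, t \in `[0, 1] -> pushforward_has_density (phi s t) rho0 (qs t)) &
          (forall q, density_path q ->
             solves_CE q (u_MCG (lik y) (p s) (u s) z0 xhat) rho0 ->
             forall t, t \in `[0, 1] ->
               lebint (fun z => (`|q t z - qs t z|)%:E) = 0%E)]) ->
  [/\ (forall s, 0 < s -> forall t, t \in `[0, 1] ->
         pushforward_has_density (phi s t) rho0
           (fun z => \sum_(n < N) lik_weight (lik y) xhat n * p s t z (z0 n) (xhat n))),
      (forall s, 0 < s ->
         pushforward_has_density (phi s 1) rho0
           (fun z => \sum_(n < N) lik_weight (lik y) xhat n * gauss (xhat n) s z)) &
      (forall f : 'rV[R]_d -> R, continuous f -> (exists M, forall z, `|f z| <= M) ->
         (fun s => lebint (fun x => (f (phi s 1 x) * rho0 x)%:E)) @ 0^'+ -->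
           (\sum_(n < N) lik_weight (lik y) xhat n * f (xhat n))%:E)].
Proof.
move=> N0 drho L0 ce p1 ppos _ uniq.
set L := lik y; set w := lik_weight L xhat.
have w0 n : 0 <= w n by exact: lik_weight_ge0.
have w1 : \sum_(n < N) w n = 1 by exact: sum_lik_weight.
have dmix s : 0 < s -> forall t, t \in `[0, 1] ->
    prob_density (fun z => \sum_(n < N) w n * p s t z (z0 n) (xhat n)).
  move=> s0 t t01; apply: prob_density_mixture => // n.
  exact: (ce s s0 (z0 n) (xhat n)).1.
have cemix s : 0 < s -> solves_CE
    (fun t z => \sum_(n < N) w n * p s t z (z0 n) (xhat n))
    (u_MCG L (p s) (u s) z0 xhat) rho0.
  move=> s0; apply: (@solves_CE_mixture _ _ _ w w1
    (fun n t z => p s t z (z0 n) (xhat n)) (fun n t z => u s t z (z0 n) (xhat n))).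
    by move=> n; exact: (ce s s0 (z0 n) (xhat n)).2.
  by move=> t z; apply: u_MCG_flux => // n; exact: ppos.
have pfmix s : 0 < s -> forall t, t \in `[0, 1] ->
    pushforward_has_density (phi s t) rho0
      (fun z => \sum_(n < N) w n * p s t z (z0 n) (xhat n)).
  move=> s0 t t01 B bB.
  (* The mixture is an admissible competitor, hence at zero L1 distance from the density [qs] of the
     pushforward. *)
  have [qs [dqs _ pfqs /(_ _ (dmix s s0) (cemix s s0) t t01) mixqs]] := uniq s s0.
  by rewrite (pfqs t t01 B bB); apply/esym/eq_indic_density => //; [exact: dmix|exact: dqs].
have t1 : (1 : R) \in `[0, 1] by rewrite in_itv /= ler01 lexx.
have p1E s n : 0 < s -> (fun z => p s 1 z (z0 n) (xhat n)) = gauss (xhat n) s.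
  by move=> s0; apply/funext => z; exact: p1.
(* The Gaussian is the conditional path at time 1, and every time slice of that path is a
   density. *)
have dgauss n s : 0 < s -> prob_density (gauss (xhat n) s).
  by move=> s0; rewrite -p1E//; exact: (ce s s0 (z0 n) (xhat n)).1.
have mix1 s : 0 < s ->
    (fun z => \sum_(n < N) w n * p s 1 z (z0 n) (xhat n)) =
    (fun z => \sum_(n < N) w n * gauss (xhat n) s z).
  by move=> s0; apply/funext => z; apply: eq_bigr => n _; rewrite p1.
have pfgauss s : 0 < s -> pushforward_has_density (phi s 1) rho0
    (fun z => \sum_(n < N) w n * gauss (xhat n) s z).
  by move=> s0; rewrite -mix1//; exact: pfmix.
split => //.
move=> f cf [M fM]; have mf := continuous_borel_measurable cf.
pose J n s := fine (\int[lebmu R d]_z (f z * gauss (xhat n) s z)%:E)%E.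
have lebE s : 0 < s -> lebint (fun x => (f (phi s 1 x) * rho0 x)%:E) =
    (\sum_(n < N) w n * J n s)%:E.
  move=> s0.
  rewrite (lebint_pushforward drho _ (pfgauss s s0) mf fM).
    by rewrite (integral_mixture w _ mf fM)// => n; exact: dgauss.
  by apply: prob_density_mixture => // n; exact: dgauss.
(* Convergence of extended reals to a finite limit: eventual finiteness, then convergence of the
   real values, which is checked component by component. *)
apply/fine_cvgP; split.
  by near=> s; rewrite lebE//; near: s; exact: nbhs_right_gt.
apply: (@cvg_trans _ ((fun s => \sum_(n < N) w n * J n s) @ 0^'+)).
  apply: near_eq_cvg; near=> s.
  by rewrite /= lebE//; near: s; exact: nbhs_right_gt.
apply: cvg_big => [|n _]; first exact: add_continuous.
apply: cvgM; first exact: cvg_cst.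
exact: (cvg_gauss_integral (dgauss n) cf fM).
Unshelve. all: by end_near. Qed.
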